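(* For each $\tau\ge1$ and each $z\in\mathcal D_\tau(T)$, the cluster transforms $\mathcal M_n^{\tau,+}(z)$ and $\mathcal M_n^{\tau,-}(z)$ satisfy, for every $n\ge1$, $$\mathcal M_n^{\tau,+}(z)=\exp\Big(\Theta_+^\tau(z)+\sum_{k=1}^nq_k^{\tau,+}\big(\mathcal M_{n-k}^{\tau,+}(z)+\mathcal M_{n-k}^{\tau,-}(z)-2\big)\Big),$$ $$\mathcal M_n^{\tau,-}(z)=\exp\Big(\Theta_-^\tau(z)+\sum_{k=1}^nq_k^{\tau,-}\big(\mathcal M_{n-k}^{\tau,+}(z)+\mathcal M_{n-k}^{\tau,-}(z)-2\big)\Big).$$ If $G_n^\tau(z):=\mathcal M_n^{\tau,+}(z)+\mathcal M_n^{\tau,-}(z)-2$, then $G_n^\tau(z)$ satisfies the closed recursion $$G_n^\tau(z)=\exp\Big(\Theta_+^\tau(z)+\sum_{k=1}^nq_k^{\tau,+}G_{n-k}^\tau(z)\Big)+\exp\Big(\Theta_-^\tau(z)+\sum_{k=1}^nq_k^{\tau,-}G_{n-k}^\tau(z)\Big)-2.$$ Moreover, $$\Phi^\tau(z,T):=\mathbb E\big[e^{zP_T^\tau}\big]=\exp\Big(\sum_{m=1}^{N_\tau}\hat\mu_\tau(m)\,G_{N_\tau-m}^\tau(z)\Big).$$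
   Context: Parameters. $\alpha\in(1/2,1)$, $\beta>1$, $\gamma,\mu,\xi_0,\theta>0$, $T>0$. For integers $\tau$ (such that $a_\tau\in(0,1)$): $a_\tau=1-\gamma\tau^{-\alpha}$, $\mu_\tau=\mu\tau^{\alpha-1}$, $N_\tau=\lfloor\tau T\rfloor$. Discrete model. $\varphi_1=1-\frac1{\Gamma(1-\alpha)}$, $\varphi_n=\frac1{\Gamma(1-\alpha)}\big((n-1)^{-\alpha}-n^{-\alpha}\big)$ for $n\ge2$, $\varphi_n^\tau=a_\tau\varphi_n$, $\hat\mu_\tau(n)=\mu_\tau+\xi_0\mu_\tau\big(\frac1{1-a_\tau}(1-\sum_{s=1}^{n-1}\varphi_s^\tau)-\sum_{s=1}^{n-1}\varphi_s^\tau\big)$. Given the past $\mathcal F_{n-1}$, $X_n^{\tau,+}$ and $X_n^{\tau,-}$ are independent Poisson variables, both with mean $\lambda_n^\tau=\hat\mu_\tau(n)+\frac1{1+\beta}\sum_{s=1}^{n-1}\varphi^\tau_{n-s}(X_s^{\tau,+}+\beta X_s^{\tau,-})$; $N_n^{\tau,\pm}=\sum_{s=1}^nX_s^{\tau,\pm}$. With $c_\tau=\sqrt{\frac{\theta(1-a_\tau)}{2\mu\tau^\alpha}}$ and $d_\tau=\frac{\theta(1-a_\tau)}{2\mu\tau^\alpha}$, the log-price is $P_T^\tau=c_\tau(N_{N_\tau}^{\tau,+}-N_{N_\tau}^{\tau,-})-d_\tau N_{N_\tau}^{\tau,+}$. The moment domain is $\mathcal D_\tau(T):=\{z\in\mathbb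 C:\mathbb E[|e^{zP_T^\tau}|]<\infty\}$. Notation. $\Theta_+^\tau(z):=z(c_\tau-d_\tau)$, $\Theta_-^\tau(z):=-zc_\tau$; $q_k^{\tau,+}:=\frac{\varphi_k^\tau}{1+\beta}$, $q_k^{\tau,-}:=\frac{\beta\varphi_k^\tau}{1+\beta}$ for $k\ge1$. Cluster transforms. Consider the two-type discrete-time branching mechanism in which an individual of type $+$ (resp. $-$) born at time $s$ produces at time $s+k$, for each $k\ge1$, independent Poisson numbers of type-$+$ and type-$-$ children, both with mean $q_k^{\tau,+}$ (resp. both with mean $q_k^{\tau,-}$), independently over lags and individuals. $\mathcal M_n^{\tau,\pm}(z)$ is the expectation of $\exp(\Theta_+^\tau(z)K_n^++\Theta_-^\tau(z)K_n^-)$, where $K_n^+$ and $K_n^-$ are the numbers of type-$+$ and type-$-$ individuals born within $n$ time steps in the cluster started from one individual (itself counted) of type $\pm$ at time $0$. In particular $\mathcal M_0^{\tau,\pm}(z)=e^{\Theta_\pm^\tau(z)}$. *)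

(* Defs.v *)
From HB Require Import structures.
From mathcomp Require Import all_boot all_order all_algebra finmap.
From mathcomp Require Import all_classical all_reals all_analysis.
From mathcomp Require Import complex.

Set Implicit Arguments.
Unset Strict Implicit.
Unset Printing Implicit Defensive.
Import Order.TTheory GRing.Theory Num.Theory.
Import numFieldNormedType.Exports.
Local Open Scope classical_set_scope.
Local Open Scope ring_scope.

Definition cexp (R : realType) (z : R[i]) : R[i] :=
  let: Complex x y := z in Complex (expR x * cos y) (expR x * sin y).

Definition cexpectation d (T : measurableType d) (R : realType)
    (P : probability T R) (f : T -> R[i]) : R[i] :=
  Complex (fine 'E_P[fun w => complex.Re (f w)])
          (fine 'E_P[fun w => complex.Im (f w)]).

Definition Gamma (R : realType) (s : R) : R :=
  \int[lebesgue_measure]_(t in `]0, +oo[) (t `^ (s - 1) * expR (- t)).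

Record params (R : realType) := Params {
  alpha : R; beta : R; gamma : R; mu : R; xi0 : R; theta : R; horizon : R }.

Section Coefficients.
Context (R : realType) (p : params R) (tau : nat).

Definition a_ : R := 1 - gamma p * tau%:R `^ (- alpha p).

Definition mu_ : R := mu p * tau%:R `^ (alpha p - 1).

Definition N_ : nat := Num.truncn (tau%:R * horizon p).

(* Only the values at n >= 1 are meaningful. *)
Definition phi (n : nat) : R :=
  match n with
  | 0 => 0
  | 1 => 1 - (Gamma (1 - alpha p))^-1
  | m.+1 => (Gamma (1 - alpha p))^-1
            * (m%:R `^ (- alpha p) - m.+1%:R `^ (- alpha p))
  end.

Definition phi_ (n : nat) : R := a_ * phi n.

Definition muhat (n : nat) : R :=
  let S := \sum_(1 <= s < n) phi_ s in
  mu_ + xi0 p * mu_ * ((1 - a_)^-1 * (1 - S) - S).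

Definition c_ : R :=
  Num.sqrt (theta p * (1 - a_) / (2 * mu p * tau%:R `^ alpha p)).

Definition d_ : R := theta p * (1 - a_) / (2 * mu p * tau%:R `^ alpha p).

(* Types + and - are encoded by true and false. *)
Definition Theta (c : bool) (z : R[i]) : R[i] :=
  if c then z * (c_ - d_)%:C%C else - z * c_%:C%C.

Definition q (c : bool) (k : nat) : R :=
  if c then phi_ k / (1 + beta p) else beta p * phi_ k / (1 + beta p).

End Coefficients.

Section Model.
Context (R : realType) (p : params R) (tau : nat).
Context d (Omega : measurableType d) (P : probability Omega R).
Variable X : nat -> bool -> {RV P >-> nat}.

Definition intensity (n : nat) (w : Omega) : R :=
  muhat p tau n + (1 + beta p)^-1 *
    \sum_(1 <= s < n) phi_ p tau (n - s)
                      * ((X s true w)%:R + beta p * (X s false w)%:R).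

Definition history (n : nat) : set (set Omega) :=
  <<s [set A | exists s c U, (0 < s <= n)%N /\ A = X s c @^-1` U] >>.

(* Integrating the joint conditional mass function over the events of the past
   characterises the conditional law. The intensity is positive, which matters
   since poisson_pmf is not a mass function at rate 0. *)
Definition price_model : Prop :=
  forall n : nat, (0 < n)%N -> forall A, history n.-1 A -> forall j k : nat,
    P (A `&` (X n true @^-1` [set j] `&` X n false @^-1` [set k])) =
    (\int[P]_(w in A) (poisson_pmf (intensity n w) j
                       * poisson_pmf (intensity n w) k)%:E)%E.

Definition count_upto (n : nat) (c : bool) (w : Omega) : nat :=
  \sum_(1 <= s < n.+1) X s c w.

Definition log_price (w : Omega) : R :=
  let Np := (count_upto (N_ p tau) true w)%:R in
  let Nm := (count_upto (N_ p tau) false w)%:R in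
  c_ p tau * (Np - Nm) - d_ p tau * Np.

Definition moment_domain : set R[i] :=
  [set z : R[i] |
    ('E_P[fun w => (ComplexField.Normc.normc
                      (cexp (z * (log_price w)%:C%C)))%R] < +oo)%E].

Definition Phi (z : R[i]) : R[i] :=
  cexpectation P (fun w => cexp (z * (log_price w)%:C%C)).

End Model.

(* Ulam-Harris label of a potential individual of the cluster: the root is
   [::], and (k, c, j) :: u is the j-th type-c child (counted from 0) that u
   produces k time steps after its own birth. *)
Definition label : Type := seq (nat * bool * nat).

Definition label_type (c0 : bool) (u : label) : bool :=
  if u is (_, c, _) :: _ then c else c0.

Definition birth_time (u : label) : nat := \sum_(e <- u) e.1.1.

Definition independent_family d (T : measurableType d) (R : realType)
    (P : probability T R) (I : choiceType) (D : set I) (Y : I -> T -> nat) :=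
  forall (F : {fset I}) (U : I -> set nat), [set` F] `<=` D ->
    P (\bigcap_(i in [set` F]) Y i @^-1` U i) =
    (\prod_(i <- F) P (Y i @^-1` U i))%E.

Section Cluster.
Context (R : realType) (p : params R) (tau : nat).
Context d (Omega : measurableType d) (P : probability Omega R).
(* xi u k c is the number of type-c children that u produces at lag k. *)
Variable xi : label -> nat -> bool -> {RV P >-> nat}.

Definition branching (c0 : bool) : Prop :=
  (forall u k c m, (0 < k)%N ->
     P (xi u k c @^-1` [set m]) =
     (poisson_pmf (q p tau (label_type c0 u) k) m)%:E) /\
  independent_family P [set i : label * nat * bool | (0 < i.1.2)%N]
    (fun i => xi i.1.1 i.1.2 i.2).

Fixpoint born (w : Omega) (u : label) : bool :=
  if u is (k, c, j) :: v then [&& born w v, (0 < k)%N & (j < xi v k c w)%N]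
  else true.

(* The set below is always finite: at most n generations are involved, each
   individual having finitely many children up to a given lag. *)
Definition K_ (c0 : bool) (n : nat) (c : bool) (w : Omega) : nat :=
  #|` fset_set [set u : label | [/\ born w u, label_type c0 u = c
                                   & (birth_time u <= n)%N]] |%fset.

Definition M_ (c0 : bool) (n : nat) (z : R[i]) : R[i] :=
  cexpectation P (fun w =>
    cexp (Theta p tau true z * (K_ c0 n true w)%:R
          + Theta p tau false z * (K_ c0 n false w)%:R)).

End Cluster.

(* Main.v *)
Require Import Defs.
From HB Require Import structures.
From mathcomp Require Import all_boot all_order all_algebra finmap.
From mathcomp Require Import all_classical all_reals all_analysis.
From mathcomp Require Import measurable_realfun complex.
From mathcomp Require Import ring lra zify.

Set Implicit Arguments.
Unset Strict Implicit.
Unset Printing Implicit Defensive.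
Import Order.TTheory GRing.Theory Num.Theory.
Import numFieldNormedType.Exports.
Local Open Scope classical_set_scope.
Local Open Scope ring_scope.

(** Why the formulas hold. Both the log-price and a cluster are exponential
    functionals of counts [Z s c] (jumps, resp. births, of type [c] at time [s]) which,
    given the past, are independent Poisson variables whose mean is affine in the
    earlier counts: an individual born at time [s] with type [c] contributes
    [q c (n - s)] to the mean at time [n]. The price has the additional mean
    [muhat n] and starts empty; a cluster has none and starts from its root.

    The mean of [exp (\sum_(s, c) u s c * Z s c)] is computed by integrating
    out the last time, then the one before, and so on. A Poisson variable of mean
    [l] satisfies [E (exp (v * Y)) = exp (l * (exp v - 1))] ([poisson_family]), so
    integrating out time [n] multiplies the mean [l] by the gain
    [exp (u n +) + exp (u n -) - 2]; since [l] is affine in the earlier counts, this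
    only modifies the weights [u s c] with [s < n] and produces an immigration
    factor ([cint_backward]). Starting from the weights [Theta], the gain met at
    time [n] depends only on the remaining time [N - n]; if [g l] denotes the gain
    with [l] steps left, then

      [g l = \sum_c (exp (Theta c + \sum_(1 <= k <= l) q c k * g (l - k)) - 1)],

    and after all times have been integrated out there remain the weights of the
    initial individuals and the immigration factors ([branching_transform]). For a
    cluster with root of type [c] this reads
    [M_n = exp (Theta c + \sum_k q c k * g (n - k))], whence [g = G] by induction on
    [n]; for the price it is the announced exponential formula with [g = G].

    Three points need work. First, conditioning is replaced by restriction to
    events: the past takes countably many values, so one integrates over each
    fibre and sums. Exchanging the sum and the integral requires absolute
    integrability, and as the modulus of [exp z] is [exp (Re z)], this is the same
    identity for real weights, where all terms are nonnegative ([cint_glue]).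
    Secondly, the Poisson transform at complex arguments relies on the power series
    of [cexp], obtained from the differential equation that it solves
    ([cexp_series]). Thirdly, for a cluster the past up to time [n] is a random
    finite tree of labels: the event that it equals a given tree prescribes
    finitely many offspring numbers, and those used at time [n + 1] are not among
    them ([revealed_uniq], [newborns_law]), which is where the independence of
    the family enters. *)

(** * Power series of the complex exponential *)

Section ComplexExponential.
Context {R : realType}.
Implicit Types (z w : R[i]) (x : R).
Local Notation Re := (@complex.Re _).
Local Notation Im := (@complex.Im _).

Lemma ReD z w : Re (z + w) = Re z + Re w. Proof. by case: z; case: w. Qed.
Lemma ImD z w : Im (z + w) = Im z + Im w. Proof. by case: z; case: w. Qed.
Lemma ReM z w : Re (z * w) = Re z * Re w - Im z * Im w.
Proof. by case: z; case: w. Qed.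
Lemma ImM z w : Im (z * w) = Re z * Im w + Im z * Re w.
Proof. by case: z; case: w. Qed.

Lemma natr_complex n : n%:R = n%:R%:C%C :> R[i].
Proof. by rewrite rmorph_nat. Qed.

Lemma Re_sum I (r : seq I) (F : I -> R[i]) :
  Re (\sum_(i <- r) F i) = \sum_(i <- r) Re (F i).
Proof. by apply: (big_morph _ ReD). Qed.

Lemma Im_sum I (r : seq I) (F : I -> R[i]) :
  Im (\sum_(i <- r) F i) = \sum_(i <- r) Im (F i).
Proof. by apply: (big_morph _ ImD). Qed.

Lemma complex_ext z w : Re z = Re w -> Im z = Im w -> z = w.
Proof. by case: z => a b; case: w => c d /= -> ->. Qed.

Lemma cexp0 : cexp (0 : R[i]) = 1.
Proof. by rewrite /cexp /= expR0 cos0 sin0 mulr1 mulr0. Qed.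

Lemma cexpD z w : cexp (z + w) = cexp z * cexp w.
Proof.
case: z => a b; case: w => c d; apply: complex_ext; rewrite ?ReM ?ImM /= expRD.
  rewrite cosD; ring.
rewrite sinD; ring.
Qed.

Lemma cexp_natr z n : cexp (z * n%:R) = cexp z ^+ n.
Proof.
elim: n => [|n IH]; first by rewrite mulr0 cexp0.
by rewrite -natr1 mulrDr mulr1 cexpD IH exprSr.
Qed.

Lemma cexp_real x : cexp x%:C%C = (expR x)%:C%C.
Proof. by rewrite /cexp /= cos0 sin0 mulr1 mulr0. Qed.

Lemma Re_cexp_le z : `|Re (cexp z)| <= expR (Re z).
Proof.
case: z => a b /=; rewrite normrM ger0_norm ?expR_ge0//.
by rewrite ler_piMr ?expR_ge0// ler_norml cos_geN1 cos_le1.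
Qed.

Lemma Im_cexp_le z : `|Im (cexp z)| <= expR (Re z).
Proof.
case: z => a b /=; rewrite normrM ger0_norm ?expR_ge0//.
by rewrite ler_piMr ?expR_ge0// ler_norml sin_geN1 sin_le1.
Qed.

(** Convergence is stated on real and imaginary parts, because the integrals
    below are real-valued; no topology on [R[i]] is involved. *)
Definition csum (f : nat -> R[i]) (s : R[i]) :=
  (series (fun k => Re (f k)) @ \oo --> Re s) /\
  (series (fun k => Im (f k)) @ \oo --> Im s).

Lemma csumZ f s w : csum f s -> csum (fun k => w * f k) (w * s).
Proof.
move=> [fs fs']; split.
  have -> : series (fun k => Re (w * f k)) =
      (fun n => Re w * series (fun k => Re (f k)) n -
                Im w * series (fun k => Im (f k)) n).
    apply/funext => n; rewrite /series/= !mulr_sumr -sumrB.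
    by apply: eq_bigr => k _; rewrite ReM.
  by rewrite ReM; apply: cvgB; apply: cvgMr.
have -> : series (fun k => Im (w * f k)) =
    (fun n => Re w * series (fun k => Im (f k)) n +
              Im w * series (fun k => Re (f k)) n).
  apply/funext => n; rewrite /series/= !mulr_sumr -big_split.
  by apply: eq_bigr => k _; rewrite ImM.
by rewrite ImM; apply: cvgD; apply: cvgMr.
Qed.

(** [A + iB] solves [y' = (p + iv) y] with [y 0 = 1], so multiplying it by
    [exp (- (p + iv) x)] gives a function with zero derivative, hence
    constantly 1. The real and imaginary parts of that product are [C] and [D]. *)
Lemma linear_ode (p v : R) (A B : R -> R) :
  (forall x, is_derive x 1 A (p * A x - v * B x)) ->
  (forall x, is_derive x 1 B (p * B x + v * A x)) ->
  A 0 = 1 -> B 0 = 0 ->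
  A 1 = expR p * cos v /\ B 1 = expR p * sin v.
Proof.
move=> dA dB A0 B0.
pose C x := expR (- (p * x)) * (A x * cos (v * x) + B x * sin (v * x)).
pose D x := expR (- (p * x)) * (B x * cos (v * x) - A x * sin (v * x)).
have dC x : is_derive x 1 C 0.
  apply: trigger_derive; rewrite /GRing.scale /=; ring.
have dD x : is_derive x 1 D 0.
  apply: trigger_derive; rewrite /GRing.scale /=; ring.
have HC : C 1 = C 0 by apply: is_derive_0_is_cst.
have HD : D 1 = D 0 by apply: is_derive_0_is_cst.
move: HC HD; rewrite /C /D !mulr0 !mulr1 !oppr0 expR0 cos0 sin0 A0 B0.
rewrite !mulr1 !mulr0 addr0 subr0 mulr0 !mulr1 => HC HD.
have E X : X = expR p * (expR (- p) * X).
  by rewrite mulrA -expRD subrr expR0 mul1r.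
(* rotating [(A 1, B 1)] back by the angle [v] recovers the values at 1 *)
have {}HC : A 1 * cos v + B 1 * sin v = expR p.
  by rewrite [LHS]E HC mulr1.
have {}HD : B 1 * cos v - A 1 * sin v = 0.
  by rewrite [LHS]E HD mulr0.
split.
  rewrite -HC; transitivity (A 1 * (cos v ^+ 2 + sin v ^+ 2) +
    sin v * (B 1 * cos v - A 1 * sin v)); last by ring.
  by rewrite cos2Dsin2 HD mulr0 addr0 mulr1.
rewrite -HC; transitivity (B 1 * (cos v ^+ 2 + sin v ^+ 2) -
  cos v * (B 1 * cos v - A 1 * sin v)); last by ring.
by rewrite cos2Dsin2 HD mulr0 subr0 mulr1.
Qed.

Section PowerSeries.
Variable w : R[i].
Let a k := Re (w ^+ k) * (k`!%:R)^-1.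
Let b k := Im (w ^+ k) * (k`!%:R)^-1.
Let p := Re w.
Let v := Im w.

Let coef_le k : `|Re (w ^+ k)| <= (`|p| + `|v|) ^+ k /\
                `|Im (w ^+ k)| <= (`|p| + `|v|) ^+ k.
Proof.
(* the l1 norm is submultiplicative, which avoids square roots *)
suff H : `|Re (w ^+ k)| + `|Im (w ^+ k)| <= (`|p| + `|v|) ^+ k.
  by split; apply: le_trans H; rewrite ?lerDl ?lerDr.
elim: k => [|k IH]; first by rewrite !expr0 /= normr0 normr1 addr0.
rewrite !exprS ReM ImM.
have : 0 <= `|p| + `|v| by rewrite addr_ge0.
move=> /ler_wpM2l/(_ _ _ IH); apply: le_trans.
have := ler_normB (Re w * Re (w ^+ k)) (Im w * Im (w ^+ k)).
have := ler_normD (Re w * Im (w ^+ k)) (Im w * Re (w ^+ k)).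
rewrite !normrM -/p -/v; lra.
Qed.

Let cvg_pow f x : (forall k, `|f k| <= (`|p| + `|v|) ^+ k) ->
  cvgn (pseries (fun k => f k * (k`!%:R)^-1) x).
Proof.
move=> Hf; apply: normed_cvg.
apply: series_le_cvg; last exact: (is_cvg_series_exp_coeff ((`|p| + `|v|) * `|x|)).
- by move=> n; rewrite normr_ge0.
- by move=> n; rewrite /exp_coeff/= divr_ge0// exprn_ge0// mulr_ge0// addr_ge0.
- move=> n /=; rewrite /exp_coeff /= !normrM normrX exprMn.
  rewrite -mulrA [X in _ * X]mulrC mulrA normfV normr_nat ler_wpM2r//.
  by rewrite ler_wpM2r// exprn_ge0.
Qed.

Let cvga x : cvgn (pseries a x).
Proof. by apply: cvg_pow => k; case: (coef_le k). Qed.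
Let cvgb x : cvgn (pseries b x).
Proof. by apply: cvg_pow => k; case: (coef_le k). Qed.

Let diffa : pseries_diffs a = (fun k => p * a k - v * b k).
Proof.
apply/funext => k; rewrite /pseries_diffs /a /b factS natrM invfM exprS ReM.
rewrite -/p -/v; field; by rewrite pnatr_eq0 -lt0n fact_gt0 nat1r pnatr_eq0.
Qed.

Let diffb : pseries_diffs b = (fun k => p * b k + v * a k).
Proof.
apply/funext => k; rewrite /pseries_diffs /a /b factS natrM invfM exprS ImM.
rewrite -/p -/v; field; by rewrite pnatr_eq0 -lt0n fact_gt0 nat1r pnatr_eq0.
Qed.

Let pseries_comb (c d : R) f g x :
  pseries (fun k => c * f k + d * g k) x = (fun n => c * pseries f x n + d * pseries g x n).
Proof.
apply/funext => n; rewrite /pseries /series /= !mulr_sumr -big_split.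
by apply: eq_bigr => k _ /=; ring.
Qed.

Let cvg_comb (c d : R) f g x l m : pseries f x @ \oo --> l -> pseries g x @ \oo --> m ->
  pseries (fun k => c * f k + d * g k) x @ \oo --> c * l + d * m.
Proof.
by move=> fl gm; rewrite pseries_comb; apply: cvgD; apply: cvgMr.
Qed.

Let A x := limn (pseries a x).
Let B x := limn (pseries b x).

Let is_cvg_comb (c d : R) f g x : cvgn (pseries f x) -> cvgn (pseries g x) ->
  cvgn (pseries (fun k => c * f k + d * g k) x).
Proof. by move=> fl gm; apply/cvg_ex; eexists; apply: cvg_comb fl gm. Qed.

Let diffsD (c d : R) f g : pseries_diffs (fun k => c * f k + d * g k) =
  (fun k => c * pseries_diffs f k + d * pseries_diffs g k) .
Proof. by apply/funext => k; rewrite /pseries_diffs; ring. Qed.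

Let diffa' : pseries_diffs a = (fun k => p * a k + (- v) * b k).
Proof. by rewrite diffa; apply/funext => k; rewrite mulNr. Qed.

Let cvgda x : cvgn (pseries (pseries_diffs a) x).
Proof. by rewrite diffa'; exact (@is_cvg_comb p (- v) a b x (@cvga x) (@cvgb x)). Qed.

Let cvgdb x : cvgn (pseries (pseries_diffs b) x).
Proof. by rewrite diffb; exact (@is_cvg_comb p v b a x (@cvgb x) (@cvga x)). Qed.

Let dA x : is_derive x 1 A (p * A x - v * B x).
Proof.
have -> : p * A x - v * B x = limn (pseries (pseries_diffs a) x).
  apply/esym/cvg_lim => //; rewrite diffa' -mulNr.
  by apply: cvg_comb; [exact: cvga|exact: cvgb].
apply: (@pseries_snd_diffs _ _ (`|x| + 1)).
- exact: cvga.
- exact: cvgda.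
- by rewrite [pseries_diffs a]diffa' diffsD; exact (@is_cvg_comb p (- v) _ _ _ (@cvgda _) (@cvgdb _)).
- by rewrite [ltRHS]ger0_norm// addrC -subr_gt0 addrK.
Qed.

Let dB x : is_derive x 1 B (p * B x + v * A x).
Proof.
have -> : p * B x + v * A x = limn (pseries (pseries_diffs b) x).
  apply/esym/cvg_lim => //; rewrite diffb.
  by apply: cvg_comb; [exact: cvgb|exact: cvga].
apply: (@pseries_snd_diffs _ _ (`|x| + 1)).
- exact: cvgb.
- exact: cvgdb.
- by rewrite [pseries_diffs b]diffb diffsD; exact (@is_cvg_comb p v _ _ _ (@cvgdb _) (@cvgda _)).
- by rewrite [ltRHS]ger0_norm// addrC -subr_gt0 addrK.
Qed.

Let A0 : A 0 = 1.
Proof.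
rewrite /A; apply: lim_near_cst => //; near=> m.
rewrite -[m]prednK; last by near: m.
rewrite /pseries /series /= big_nat_recl//= expr0 mulr1 /a expr0 /= fact0 invr1 mulr1.
by rewrite big1 ?addr0// => i _; rewrite expr0n mulr0.
Unshelve. all: by end_near. Qed.

Let B0 : B 0 = 0.
Proof.
rewrite /B; apply: lim_near_cst => //; near=> m.
rewrite -[m]prednK; last by near: m.
rewrite /pseries /series /= big_nat_recl//= expr0 mulr1 /b expr0 /= mul0r.
by rewrite big1 ?addr0// => i _; rewrite expr0n mulr0.
Unshelve. all: by end_near. Qed.

(** The power series in a real variable [x] with coefficients [w ^+ k / k!]
    can be differentiated term by term, which multiplies it by [w]: its two
    components satisfy [linear_ode], and [x = 1] is the claim. *)
Lemma cexp_series : csum (fun k => (k`!%:R^-1)%:C%C * w ^+ k) (cexp w).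
Proof.
have [HA HB] := linear_ode dA dB A0 B0.
split.
  have -> : Re (cexp w) = A 1 by rewrite HA /p /v; case: (w).
  have -> : series (fun k => Re ((k`!%:R^-1)%:C%C * w ^+ k)) = pseries a 1.
    congr series; apply/funext => k.
    by rewrite ReM /= mul0r subr0 expr1n mulr1 /a mulrC.
  exact: cvga.
have -> : Im (cexp w) = B 1 by rewrite HB /p /v; case: (w).
have -> : series (fun k => Im ((k`!%:R^-1)%:C%C * w ^+ k)) = pseries b 1.
  congr series; apply/funext => k.
  by rewrite ImM /= mul0r addr0 expr1n mulr1 /b mulrC.
exact: cvgb.
Qed.

End PowerSeries.
End ComplexExponential.

(** * Complex-valued integrals over countable partitions *)

Section CountableIntegral.
Context d (T : measurableType d) (R : realType).
Variable P : probability T R.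
Implicit Types (A : set T) (Y : T -> nat).

Lemma nneseries_EFin_cvg (r : R^nat) (x : R) : (forall k, 0 <= r k) ->
  (\sum_(k <oo) (r k)%:E = x%:E)%E <-> series r @ \oo --> x.
Proof.
move=> r0.
have E : (fun n => \sum_(0 <= k < n) (r k)%:E)%E = EFin \o series r.
  by apply/funext => n; rewrite /series/= sumEFin.
rewrite E; split => [h|h].
  have : (EFin \o series r) @ \oo --> x%:E.
    by rewrite -h -E; apply: is_cvg_nneseries => k _ _; rewrite lee_fin.
  by move/fine_cvg.
by apply/cvg_lim => //; apply: cvg_EFin; [exact: nearW | exact: h].
Qed.

Lemma trivIset_fiber A Y : trivIset setT (fun k => A `&` Y @^-1` [set k]).
Proof. by move=> i j _ _ [w [[_ <-] [_ <-]]]. Qed.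

Lemma bigcup_fiber A Y : \bigcup_k (A `&` Y @^-1` [set k]) = A.
Proof.
apply/seteqP; split => [w [k _ []]//|w Aw]; by exists (Y w).
Qed.

Variables (A : set T) (Y : T -> nat).
Hypothesis mA : measurable A.
Hypothesis mY : forall k, measurable (Y @^-1` [set k]).
Let Ak k := A `&` Y @^-1` [set k].
Let mAk k : measurable (Ak k). Proof. exact: measurableI. Qed.

Lemma measurable_fun_fiber d' (T' : measurableType d') (g : T -> T') :
  (forall k, measurable_fun (Ak k) g) -> measurable_fun A g.
Proof. by move=> h; rewrite -(bigcup_fiber A Y); apply/measurable_fun_bigcup. Qed.

(** A function that factors through a countably-valued measurable [Y] needs no
    measurability of its own: it is constant on each fibre of [Y]. *)
Lemma measurable_fun_determined d' (T' : measurableType d') (g : T -> T') :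
  (forall w w', Y w = Y w' -> g w = g w') -> measurable_fun A g.
Proof.
move=> h; apply: measurable_fun_fiber => k.
have [[w0 Yw0]|no] := pselect (exists w, Y w = k); last first.
  rewrite (_ : Ak k = set0); first exact: measurable_fun_set0.
  by apply/seteqP; split => // w [_ Yw]; case: no; exists w.
apply: (@eq_measurable_fun _ _ _ _ _ (cst (g w0))); last exact: measurable_cst.
by move=> w /[!inE] -[_ /= Yw]; apply: h; rewrite Yw.
Qed.

Lemma ge0_series_integral (g : T -> R) (r : R^nat) (x : R) :
  (forall w, A w -> 0 <= g w) ->
  (forall k, measurable_fun (Ak k) g) ->
  (forall k, \int[P]_(w in Ak k) (g w)%:E = (r k)%:E)%E ->
  (\int[P]_(w in A) (g w)%:E = x%:E)%E <-> series r @ \oo --> x.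
Proof.
move=> g0 mg hr; rewrite -nneseries_EFin_cvg; last first.
  move=> k; rewrite -lee_fin -hr; apply: integral_ge0 => w [Aw _].
  by rewrite lee_fin g0.
have mgA := measurable_fun_fiber mg.
rewrite -{1}(bigcup_fiber A Y) ge0_integral_bigcup//.
- by under eq_eseriesr do rewrite hr.
- by rewrite /= bigcup_fiber; exact/measurable_EFinP.
- by rewrite /= bigcup_fiber => w Aw; rewrite lee_fin g0.
- exact: trivIset_fiber.
Qed.

(** An infinite sum of extended reals is defined even when it diverges; splitting [g]
    into positive and negative parts turns it into a genuine convergence
    statement, which is what [csum] asks for. *)
Lemma integrable_series (g : T -> R) (r : R^nat) (x : R) :
  P.-integrable A (EFin \o g) ->
  (forall k, \int[P]_(w in Ak k) (g w)%:E = (r k)%:E)%E ->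
  (\int[P]_(w in A) (g w)%:E = x%:E)%E ->
  series r @ \oo --> x.
Proof.
move=> ig hr hx.
have igk k : P.-integrable (Ak k) (EFin \o g) by apply: integrableS ig => // w [].
pose gp w := Num.max (g w) 0; pose gn w := Num.max (- g w) 0.
have Ep : (EFin \o g)^\+%E = EFin \o gp.
  by apply/funext => w; rewrite funeposE /gp /= EFin_max.
have En : (EFin \o g)^\-%E = EFin \o gn.
  by apply/funext => w; rewrite funenegE /gn /= EFin_max.
have fin B h : measurable B -> P.-integrable B (EFin \o h) ->
    (\int[P]_(w in B) (h w)%:E = (fine (\int[P]_(w in B) (h w)%:E))%:E)%E.
  by move=> mB ih; rewrite fineK//; exact: integrable_fin_num.
have ip B : measurable B -> P.-integrable B (EFin \o g) -> P.-integrable B (EFin \o gp).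
  by move=> mB ?; rewrite -Ep; apply: integrable_funepos.
have in_ B : measurable B -> P.-integrable B (EFin \o g) -> P.-integrable B (EFin \o gn).
  by move=> mB ?; rewrite -En; apply: integrable_funeneg.
have EB B : measurable B -> P.-integrable B (EFin \o g) ->
    (\int[P]_(w in B) (g w)%:E = (fine (\int[P]_(w in B) (gp w)%:E) -
       fine (\int[P]_(w in B) (gn w)%:E))%:E)%E.
  by move=> mB iB; rewrite EFinB -fin ?ip// -fin ?in_// integralE Ep En.
have := EB _ mA ig; rewrite hx => -[->].
have -> : r = (fun k => fine (\int[P]_(w in Ak k) (gp w)%:E) -
                     fine (\int[P]_(w in Ak k) (gn w)%:E)).
  by apply/funext => k; have := EB _ (mAk k) (igk k); rewrite hr => -[].
set rp := fun k => fine (\int[P]_(w in Ak k) (gp w)%:E).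
set rn := fun k => fine (\int[P]_(w in Ak k) (gn w)%:E).
rewrite (_ : series _ = (fun n => series rp n - series rn n)); last first.
  by apply/funext => n; rewrite /series /= sumrB.
apply: cvgB.
  apply/(@ge0_series_integral gp) => //.
  - by move=> w _; rewrite le_max lexx orbT.
  - by move=> k; apply/measurable_EFinP; apply: measurable_int (ip _ (mAk k) (igk k)).
  - by move=> k; rewrite -fin ?ip.
  - by rewrite -fin ?ip.
apply/(@ge0_series_integral gn) => //.
- by move=> w _; rewrite le_max lexx orbT.
- by move=> k; apply/measurable_EFinP; apply: measurable_int (in_ _ (mAk k) (igk k)).
- by move=> k; rewrite -fin ?in_.
- by rewrite -fin ?in_.
Qed.

End CountableIntegral.

Section ComplexIntegral.
Context d (T : measurableType d) (R : realType).
Variable P : probability T R.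
Implicit Types (A : set T) (Y : T -> nat) (f : T -> R[i]).
Local Notation Re := (@complex.Re _).
Local Notation Im := (@complex.Im _).

(** [f] is integrable on [A] with integral [m]. Keeping integrability and value
    in one relation lets both be propagated by the same inductions. *)
Definition cint A f (m : R[i]) : Prop :=
  [/\ P.-integrable A (EFin \o (Re \o f)), P.-integrable A (EFin \o (Im \o f)),
      (\int[P]_(w in A) (Re (f w))%:E = (Re m)%:E)%E &
      (\int[P]_(w in A) (Im (f w))%:E = (Im m)%:E)%E].

Lemma cint_cexpectation f m : cint setT f m -> cexpectation P f = m.
Proof.
move=> [_ _ a b]; rewrite /cexpectation unlock /= a b /=.
by case: (m).
Qed.

Lemma eq_cint A f g m : measurable A -> (forall w, A w -> f w = g w) ->
  cint A f m -> cint A g m.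
Proof.
move=> mA fg [ir ii er ei]; split.
- by apply: eq_integrable ir => // w /[!inE] Aw /=; rewrite fg.
- by apply: eq_integrable ii => // w /[!inE] Aw /=; rewrite fg.
- by rewrite -er; apply: eq_integral => w /[!inE] Aw; rewrite fg.
- by rewrite -ei; apply: eq_integral => w /[!inE] Aw; rewrite fg.
Qed.

Lemma cint_cst A (c : R) (k : R[i]) : measurable A -> P A = c%:E ->
  cint A (fun=> k) (k * c%:C%C).
Proof.
move=> mA PA.
have i (r : R) : P.-integrable A (cst r%:E).
  by apply/finite_measure_integrable_cst.
split.
- exact: i.
- exact: i.
- by rewrite integral_cst// [X in (_ * X)%E]PA -EFinM ReM /= mulr0 subr0.
- by rewrite integral_cst// [X in (_ * X)%E]PA -EFinM ImM /= mulr0 add0r.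
Qed.

Lemma cintZ A f m (k : R[i]) : measurable A -> cint A f m ->
  cint A (fun w => k * f w) (k * m).
Proof.
move=> mA [ir ii er ei].
have iZ (r : R) (g : T -> R) : P.-integrable A (EFin \o g) ->
    P.-integrable A (fun w => (r * g w)%:E).
  move=> ig; have := integrableZl mA r ig.
  by apply: eq_integrable => // w _; rewrite /= EFinM.
have eZ (r : R) (g : T -> R) x : P.-integrable A (EFin \o g) ->
    (\int[P]_(w in A) (g w)%:E = x%:E)%E ->
    (\int[P]_(w in A) (r * g w)%:E = (r * x)%:E)%E.
  by move=> ig gx; under eq_integral do rewrite EFinM; rewrite integralZl// gx.
split.
- have := integrableB mA (iZ (Re k) _ ir) (iZ (Im k) _ ii).
  by apply: eq_integrable => // w _; rewrite /= ReM EFinB.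
- have := integrableD mA (iZ (Re k) _ ii) (iZ (Im k) _ ir).
  by apply: eq_integrable => // w _; rewrite /= ImM EFinD.
- under eq_integral do rewrite ReM EFinB.
  rewrite integralB//; [|exact: iZ ir|exact: iZ ii].
  by rewrite (eZ _ _ _ ir er) (eZ _ _ _ ii ei) ReM EFinB.
- under eq_integral do rewrite ImM EFinD.
  rewrite integralD//; [|exact: iZ ii|exact: iZ ir].
  by rewrite (eZ _ _ _ ir er) (eZ _ _ _ ii ei) ImM EFinD.
Qed.

Lemma cint_null A f : measurable A -> P A = 0 ->
  measurable_fun A (Re \o f) -> measurable_fun A (Im \o f) -> cint A f 0.
Proof.
move=> mA PA0 mr mi.
have mr' : measurable_fun A (EFin \o (Re \o f)) by exact/measurable_EFinP.
have mi' : measurable_fun A (EFin \o (Im \o f)) by exact/measurable_EFinP.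
split; [exact: null_set_integrable|exact: null_set_integrable| |].
- exact: (null_set_integral mA mr').
- exact: (null_set_integral mA mi').
Qed.

Section Fibers.
Variables (A : set T) (Y : T -> nat).
Hypothesis mA : measurable A.
Hypothesis mY : forall k, measurable (Y @^-1` [set k]).

Lemma cint_csum f m (mk : nat -> R[i]) : cint A f m ->
  (forall k, cint (A `&` Y @^-1` [set k]) f (mk k)) -> csum mk m.
Proof.
move=> [ir ii er ei] hk; split.
  by apply: (integrable_series mA mY ir _ er) => k; case: (hk k).
by apply: (integrable_series mA mY ii _ ei) => k; case: (hk k).
Qed.

(** Summing integrals of [f] over the fibres of [Y] is legitimate as soon as a
    dominating [h] has summable integrals over them. In the applications [h]
    is [f] with its exponents replaced by their real parts, so that the
    summability of the [rk] is an instance of the identity being proved. *)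
Lemma cint_glue f h m rho (mk rk : nat -> R[i]) :
  (forall w, A w -> `|Re (f w)| <= Re (h w) /\ `|Im (f w)| <= Re (h w)) ->
  (forall k, cint (A `&` Y @^-1` [set k]) f (mk k)) ->
  (forall k, cint (A `&` Y @^-1` [set k]) h (rk k)) ->
  csum rk rho -> csum mk m -> cint A f m.
Proof.
move=> fh hf hh [srk _] [smk smk'].
have mI (g : T -> R) : (forall k, P.-integrable (A `&` Y @^-1` [set k]) (EFin \o g)) ->
    measurable_fun A g.
  move=> hg; apply: (measurable_fun_fiber mA mY) => k.
  by apply/measurable_EFinP; exact: measurable_int (hg k).
have mh : measurable_fun A (Re \o h) by apply: mI => k; case: (hh k).
have mfr : measurable_fun A (Re \o f) by apply: mI => k; case: (hf k).
have mfi : measurable_fun A (Im \o f) by apply: mI => k; case: (hf k).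
have h0 w : A w -> 0 <= Re (h w) by move=> /fh [+ _]; exact: le_trans.
have Eh : (\int[P]_(w in A) (Re (h w))%:E = (Re rho)%:E)%E.
  apply: (iffRL (@ge0_series_integral _ _ _ P A Y mA mY (Re \o h) _ _ h0 _ _)) srk.
  - by move=> k; apply: measurable_funS mh => // w [].
  - by move=> k; case: (hh k).
have ih : P.-integrable A (EFin \o (Re \o h)).
  apply/integrableP; split; first exact/measurable_EFinP.
  under eq_integral => w /[!inE] Aw do rewrite /= ger0_norm ?h0//.
  by rewrite Eh ltry.
have ir : P.-integrable A (EFin \o (Re \o f)).
  apply: le_integrable ih => //; first exact/measurable_EFinP.
  by move=> w Aw /=; rewrite lee_fin [leRHS]ger0_norm ?h0//; case: (fh w Aw).
have ii : P.-integrable A (EFin \o (Im \o f)).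
  apply: le_integrable ih => //; first exact/measurable_EFinP.
  by move=> w Aw /=; rewrite lee_fin [leRHS]ger0_norm ?h0//; case: (fh w Aw).
have val (g : T -> R) (r : R^nat) x : P.-integrable A (EFin \o g) ->
    (forall k, \int[P]_(w in A `&` Y @^-1` [set k]) (g w)%:E = (r k)%:E)%E ->
    series r @ \oo --> x -> (\int[P]_(w in A) (g w)%:E = x%:E)%E.
  move=> ig gr rx; have fg := integrable_fin_num mA ig.
  rewrite -(fineK fg); congr EFin; apply: (cvg_unique _ _ rx) => //.
  by apply: (integrable_series mA mY ig gr); rewrite fineK.
split => //.
  by apply: val ir _ smk => k; case: (hf k).
by apply: val ii _ smk' => k; case: (hf k).
Qed.

End Fibers.
End ComplexIntegral.

(** * Transforms of Poisson families *)

Section Poisson.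
Context {R : realType}.
Local Notation Re := (@complex.Re _).
Local Notation Im := (@complex.Im _).

(** The modulus of an exponential depends only on the real part of its exponent. *)
Lemma cexp_dominated (z z' : R[i]) : Re z' = Re z -> Im z' = 0 ->
  `|Re (cexp z)| <= Re (cexp z') /\ `|Im (cexp z)| <= Re (cexp z').
Proof.
move=> er ei; have -> : Re (cexp z') = expR (Re z).
  by case: z' er ei => a b /= -> ->; rewrite cos0 mulr1.
by split; [exact: Re_cexp_le|exact: Im_cexp_le].
Qed.

(** The transform of the Poisson law is the exponential series at
    [l * cexp v]. *)
Lemma poisson_csum (l : R) (v k : R[i]) : 0 < l ->
  csum (fun n => k * ((poisson_pmf l n)%:C%C * cexp (v * n%:R)))
       (k * cexp (l%:C%C * (cexp v - 1))).
Proof.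
move=> l0; have -> : k * cexp (l%:C%C * (cexp v - 1)) =
    (k * cexp (- l%:C%C)) * cexp (l%:C%C * cexp v).
  by rewrite mulrBr mulr1 cexpD; ring.
congr (csum _ _): (csumZ (k * cexp (- l%:C%C)) (cexp_series (l%:C%C * cexp v))).
apply/funext => n.
rewrite /poisson_pmf l0 cexp_natr exprMn -rmorphN cexp_real !rmorphM rmorphXn /=.
ring.
Qed.

Context d (T : measurableType d) (P : probability T R).

(** On the event [A], the family [Y] has the law of independent Poisson variables
    up to the constant [c], which is then necessarily the probability of [A].
    Leaving [c] free makes the hypothesis stable under further conditioning:
    in the induction one splits [A] according to the value [k] of the first
    variable, and [A] with [Y i = k] satisfies the same hypothesis with [c]
    multiplied by the mass of [k]. *)
Lemma poisson_family (J : eqType) (Y : J -> T -> nat) (l : J -> R) (s : seq J) :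
  (forall i k, measurable (Y i @^-1` [set k])) ->
  uniq s -> (forall i, i \in s -> 0 < l i) ->
  forall (A : set T) (c : R), measurable A ->
  (forall k : J -> nat, P (A `&` [set w | all (fun i => Y i w == k i) s]) =
     (c * \prod_(i <- s) poisson_pmf (l i) (k i))%:E) ->
  forall v : J -> R[i],
  cint P A (fun w => cexp (\sum_(i <- s) v i * (Y i w)%:R))
    (c%:C%C * cexp (\sum_(i <- s) (l i)%:C%C * (cexp (v i) - 1))).
Proof.
move=> mY; elim: s => [_ _ A c mA hA v|i s IH /= /andP[si us] hl A c mA hA].
  rewrite big_nil cexp0 mulrC.
  apply: (@eq_cint _ _ _ _ _ (fun=> 1)) => //; first by move=> w _; rewrite big_nil cexp0.
  apply: cint_cst => //.
  rewrite -[c]mulr1; have := hA (fun=> 0%N); rewrite big_nil => <-; congr (P _).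
  by apply/seteqP; split => [w Aw //|w []].
set E := fun v : J -> R[i] => cexp (\sum_(j <- s) (l j)%:C%C * (cexp (v j) - 1)).
pose m (v : J -> R[i]) k := (c%:C%C * E v) * ((poisson_pmf (l i) k)%:C%C * cexp (v i * k%:R)).
pose f (v : J -> R[i]) w := cexp (\sum_(j <- i :: s) v j * (Y j w)%:R).
have piece v k : cint P (A `&` Y i @^-1` [set k]) (f v) (m v k).
  have mAk : measurable (A `&` Y i @^-1` [set k]) by apply: measurableI.
  have -> : m v k = cexp (v i * k%:R) * ((c * poisson_pmf (l i) k)%:C%C * E v).
    by rewrite /m rmorphM /=; ring.
  apply: (eq_cint mAk _ (cintZ _ mAk (IH us _ _ _ mAk _ v))).
  - by move=> w [_ <-]; rewrite /f big_cons cexpD.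
  - by move=> j js; apply: hl; rewrite inE js orbT.
  move=> k'; pose k'' j := if j == i then k else k' j.
  have ki : k'' i = k by rewrite /k'' eqxx.
  have := hA k''; rewrite big_cons ki mulrA => E1.
  have -> : \prod_(j <- s) poisson_pmf (l j) (k' j) =
            \prod_(j <- s) poisson_pmf (l j) (k'' j).
    rewrite !big_seq; apply: eq_bigr => j js; rewrite /k''.
    by case: eqP js si => // -> ->.
  rewrite -E1; congr (P _).
  have ea w : all (fun j => Y j w == k'' j) s = all (fun j => Y j w == k' j) s.
    apply: eq_in_all => j js; rewrite /k''.
    by case: (j =P i) js si => // -> ->.
  apply/seteqP; split => w /=.
    by rewrite ea => -[[Aw ->] ->]; rewrite eqxx.
  by rewrite ea => -[Aw /andP[/eqP-> ->]].
(* applied to [v] this is the claimed value, applied to the real parts [v'] of [v]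
   it makes the dominating function summable *)
have sm v : csum (m v) (c%:C%C * cexp (\sum_(j <- i :: s) (l j)%:C%C * (cexp (v j) - 1))).
  have -> : c%:C%C * cexp (\sum_(j <- i :: s) (l j)%:C%C * (cexp (v j) - 1)) =
    (c%:C%C * E v) * cexp ((l i)%:C%C * (cexp (v i) - 1)).
    by rewrite big_cons cexpD /E; ring.
  by apply: poisson_csum; apply: hl; rewrite inE eqxx.
move=> v; pose v' j := (Re (v j))%:C%C : R[i].
apply: (cint_glue mA (mY i) _ (piece v) (piece v') (sm v') (sm v)) => w _.
apply: cexp_dominated.
  by rewrite !Re_sum; apply: eq_bigr => j _; rewrite !ReM !natr_complex /= !mulr0.
by rewrite Im_sum big1// => j _; rewrite ImM natr_complex /= mulr0 mul0r addr0.
Qed.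

End Poisson.

(** * Backward recursion for discrete-time branching with immigration *)

(** Both models are cases of the following situation. [Z s c] counts the
    individuals of type [c] born at time [s]; given the past up to time [n],
    the two counts at time [n + 1] are independent Poisson variables with common
    mean [rate (n + 1)], which is affine in the earlier counts. The past up to
    time [n] is encoded by a natural number [code n], so that conditioning on it
    means restricting to one of countably many events.

    A weight [u s c] is a complex cost per individual born at time [s] with
    type [c]. Integrating out time [n] in the mean of the exponential of the total
    cost replaces the counts at time [n] by [rate n] times [offspring_gain n u];
    as [rate n] is affine in the earlier counts, the result is again the
    exponential of a total cost, for the weight [backward n u], times a
    deterministic immigration factor. *)
Section BranchingTransform.
Context {R : realType} d (T : measurableType d) (P : probability T R).
Local Notation Re := (@complex.Re _).
Local Notation Im := (@complex.Im _).
Variables (offspring : bool -> nat -> R) (immigration : nat -> R).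
Variables (Z : nat -> bool -> T -> nat) (code : nat -> T -> nat).
Variable z0 : bool -> nat.

Definition exponent n (u : nat -> bool -> R[i]) (w : T) : R[i] :=
  \sum_(0 <= s < n) \sum_c u s c * (Z s c w)%:R.

Definition rate n (w : T) : R :=
  immigration n + \sum_(0 <= s < n) \sum_c offspring c (n - s) * (Z s c w)%:R.

Definition fiber n w0 := code n @^-1` [set code n w0].

Hypothesis mcode : forall n k, measurable (code n @^-1` [set k]).
Hypothesis Z_init : forall c w, Z 0 c w = z0 c.
Hypothesis Z_code : forall n w w', code n w = code n w' ->
  forall s c, (s <= n)%N -> Z s c w = Z s c w'.
Hypothesis Z_law : forall n w0 (v : bool -> R[i]),
  cint P (fiber n w0) (fun w => cexp (\sum_c v c * (Z n.+1 c w)%:R))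
    ((fine (P (fiber n w0)))%:C%C *
     cexp ((rate n.+1 w0)%:C%C * \sum_c (cexp (v c) - 1))).

Definition offspring_gain n (u : nat -> bool -> R[i]) : R[i] :=
  \sum_c (cexp (u n c) - 1).

Definition backward n (u : nat -> bool -> R[i]) s c : R[i] :=
  u s c + (offspring c (n - s))%:C%C * offspring_gain n u.

Lemma exponentS n u w :
  exponent n.+1 u w = exponent n u w + \sum_c u n c * (Z n c w)%:R.
Proof. by rewrite /exponent big_nat_recr. Qed.

Lemma exponent_backward n u w :
  exponent n.+1 (backward n.+1 u) w + (immigration n.+1)%:C%C * offspring_gain n.+1 u =
  exponent n.+1 u w + (rate n.+1 w)%:C%C * offspring_gain n.+1 u.
Proof.
rewrite /rate rmorphD mulrDl [in RHS]addrCA [LHS]addrC; congr (_ + _).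
rewrite rmorph_sum mulr_suml -big_split; apply: eq_bigr => s _.
rewrite rmorph_sum mulr_suml -big_split; apply: eq_bigr => c _ /=.
by rewrite /backward rmorphM natr_complex; ring.
Qed.

(** Over one fibre of [code n] the earlier counts are constant, so integrating
    out time [n + 1] is exactly [Z_law]. *)
Lemma cint_fiber n u k : exists m,
  cint P (setT `&` code n @^-1` [set k]) (fun w => cexp (exponent n.+2 u w)) m /\
  cint P (setT `&` code n @^-1` [set k])
    (fun w => cexp ((immigration n.+1)%:C%C * offspring_gain n.+1 u) *
              cexp (exponent n.+1 (backward n.+1 u) w)) m.
Proof.
rewrite setTI; have mk := mcode n k.
(* an empty fibre contributes nothing; otherwise [w0] represents it *)
have [[w0 <-]|h] := pselect (exists w0, code n w0 = k); last first.
  exists 0; have E0 : code n @^-1` [set k] = set0.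
    by apply/seteqP; split => // w /= wk; case: h; exists w.
  rewrite E0; split; apply: cint_null; rewrite ?measure0//; exact: measurable_fun_set0.
have mf : measurable (fiber n w0) by exact: mcode.
have ex v w : fiber n w0 w -> exponent n.+1 v w = exponent n.+1 v w0.
  move=> fw; rewrite /exponent !big_nat; apply: eq_bigr => s /andP[_ sn].
  by apply: eq_bigr => c _; rewrite (Z_code fw).
exists (cexp (exponent n.+1 u w0) * ((fine (P (fiber n w0)))%:C%C *
    cexp ((rate n.+1 w0)%:C%C * offspring_gain n.+1 u))); split.
  apply: (eq_cint mf _ (cintZ _ mf (Z_law n w0 (u n.+1)))) => w fw.
  by rewrite [exponent n.+2 _ _]exponentS cexpD ex.
rewrite [X in cint _ _ _ X]mulrCA -cexpD -exponent_backward [_ + _ * _]addrC.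
rewrite [X in cint _ _ _ X]mulrC.
apply: (@eq_cint _ _ _ _ _ (fun=> cexp ((immigration n.+1)%:C%C * offspring_gain n.+1 u +
    exponent n.+1 (backward n.+1 u) w0))) => //.
  by move=> w fw; rewrite -cexpD ex.
by apply: cint_cst => //; rewrite fineK//; exact: fin_num_measure.
Qed.

Definition real_part (u : nat -> bool -> R[i]) s c : R[i] := (Re (u s c))%:C%C.

Lemma cint_backward n u m rho :
  cint P setT (fun w => cexp (exponent n.+1 (backward n.+1 (real_part u)) w)) rho ->
  cint P setT (fun w => cexp (exponent n.+1 (backward n.+1 u) w)) m ->
  cint P setT (fun w => cexp (exponent n.+2 u w))
    (cexp ((immigration n.+1)%:C%C * offspring_gain n.+1 u) * m).
Proof.
move=> hr hm.
have [mk hk] := choice (cint_fiber n u).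
have [rk hrk] := choice (cint_fiber n (real_part u)).
have mT : measurable (setT : set T) by [].
apply: (cint_glue mT (mcode n) (h := fun w => cexp (exponent n.+2 (real_part u) w))
  (mk := mk) (rk := rk)).
- move=> w _; apply: cexp_dominated; rewrite /exponent.
    rewrite !Re_sum; apply: eq_bigr => s _; rewrite !Re_sum; apply: eq_bigr => c _.
    by rewrite !ReM !natr_complex /= !mulr0.
  rewrite Im_sum big1// => s _; rewrite Im_sum big1// => c _.
  by rewrite ImM natr_complex /= mulr0 mul0r addr0.
- by move=> k; case: (hk k).
- by move=> k; case: (hrk k).
- by apply: (cint_csum mT (mcode n) (cintZ _ mT hr)) => k; exact: (hrk k).2.
- by apply: (cint_csum mT (mcode n) (cintZ _ mT hm)) => k; exact: (hk k).2.
Qed.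

Lemma cint_exponent1 u :
  cint P setT (fun w => cexp (exponent 1 u w)) (cexp (\sum_c u 0%N c * (z0 c)%:R)).
Proof.
rewrite -[X in cint _ _ _ X]mulr1.
apply: (@eq_cint _ _ _ _ _ (fun=> cexp (\sum_c u 0%N c * (z0 c)%:R))) => //.
  move=> w _; rewrite /exponent big_nat1; congr cexp.
  by apply: eq_bigr => c _; rewrite Z_init.
by apply: (cint_cst (c := 1)) => //; exact: probability_setT.
Qed.

(** Every weight has a finite exponential moment, since there are finitely many
    times to integrate out. The statement has to quantify over all weights: the
    domination in [cint_backward] concerns [backward] of the real part of [u],
    which differs from the real part of [backward n u]. *)
Lemma cint_exponent n u :
  exists m, cint P setT (fun w => cexp (exponent n.+1 u w)) m.
Proof.
elim: n u => [|n IH] u; first by eexists; exact: cint_exponent1.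
have [m hm] := IH (backward n.+1 u).
have [rho hrho] := IH (backward n.+1 (real_part u)).
by eexists; exact: cint_backward hrho hm.
Qed.

Section ClosedForm.
Variables (theta : bool -> R[i]) (N : nat) (g : nat -> R[i]).
Hypothesis g_rec : forall l, (l < N)%N ->
  g l = \sum_c (cexp (theta c + \sum_(1 <= k < l.+1) (offspring c k)%:C%C * g (l - k)%N) - 1).

(** The weight obtained from the constant costs [theta] by integrating out the
    times [N], [N - 1], ..., [j + 1]: an individual born at time [s] pays for itself
    and for the expected gain of each of its litters born at those times. *)
Definition weight j s c : R[i] :=
  theta c + \sum_(j.+1 <= r < N.+1) (offspring c (r - s))%:C%C * g (N - r)%N.

(** Only the time left before the horizon [N] matters, which is why a single
    sequence [g] describes all the gains. *)
Lemma offspring_gain_weight j : (j < N)%N ->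
  offspring_gain j.+1 (weight j.+1) = g (N - j.+1)%N.
Proof.
move=> jN; rewrite g_rec ?ltn_subrL ?(leq_trans _ jN)//.
apply: eq_bigr => c _; congr (cexp (_ + _) - 1).
have -> : N.+1 = ((N - j.+1).+1 + j.+1)%N by lia.
rewrite -[j.+2]add1n big_addn addnK !big_nat; apply: eq_bigr => k /andP[k0 kN].
by rewrite addnK; congr (_ * g _); lia.
Qed.

Lemma backward_weight j : (j < N)%N ->
  backward j.+1 (weight j.+1) = weight j.
Proof.
move=> jN; apply/funext => s; apply/funext => c.
rewrite /backward offspring_gain_weight// /weight -addrA; congr (_ + _).
by rewrite addrC -big_ltn.
Qed.

Lemma cint_weight j : (j <= N)%N ->
  cint P setT (fun w => cexp (exponent j.+1 (weight j) w))
    (cexp (\sum_c weight 0 0 c * (z0 c)%:R +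
           \sum_(1 <= m < j.+1) (immigration m)%:C%C * g (N - m)%N)).
Proof.
elim: j => [_|j IH jN].
  by rewrite big_geq// addr0; exact: cint_exponent1.
have [rho hrho] := cint_exponent j (backward j.+1 (real_part (weight j.+1))).
rewrite big_nat_recr//= addrA addrC cexpD -offspring_gain_weight//.
apply: cint_backward hrho _; rewrite backward_weight//; apply: IH; exact: ltnW.
Qed.

(** All times up to [N] have been integrated out: what remains is the cost of
    the [z0] initial individuals and the immigration factors. The hypothesis on
    [g] is needed below [N] only, which lets [g] be defined from the very means
    that this lemma computes. *)
Lemma branching_transform :
  cint P setT (fun w => cexp (\sum_c theta c * (\sum_(0 <= s < N.+1) Z s c w)%:R))
    (cexp (\sum_c (theta c + \sum_(1 <= k < N.+1) (offspring c k)%:C%C * g (N - k)%N) * (z0 c)%:R +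
           \sum_(1 <= m < N.+1) (immigration m)%:C%C * g (N - m)%N)).
Proof.
have := cint_weight (leqnn N).
have -> : \sum_c weight 0 0 c * (z0 c)%:R =
    \sum_c (theta c + \sum_(1 <= k < N.+1) (offspring c k)%:C%C * g (N - k)%N) * (z0 c)%:R.
  apply: eq_bigr => c _; congr ((_ + _) * _); apply: eq_bigr => k _; by rewrite subn0.
apply: eq_cint => // w _; congr cexp; rewrite /exponent exchange_big.
apply: eq_bigr => c _; rewrite natr_sum mulr_sumr; apply: eq_bigr => s _.
by rewrite /weight [\sum_(N.+1 <= r < N.+1) _]big_geq// addr0.
Qed.

End ClosedForm.
End BranchingTransform.

(** * The log-price *)

Section PriceTransform.
Context (R : realType) (p : params R) (tau : nat).
Context d (Omega : measurableType d) (P : probability Omega R).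
Variable X : nat -> bool -> {RV P >-> nat}.
Hypothesis hX : price_model p tau X.

Lemma measurable_RV_fiber (Y : {RV P >-> nat}) (U : set nat) :
  measurable (Y @^-1` U).
Proof. by rewrite -[X in measurable X]setTI; exact: measurable_funP. Qed.

(** Time 0 is the initial generation of the branching scheme; the price has no
    jump there. *)
Definition jumps s c (w : Omega) : nat := if s is 0 then 0%N else X s c w.

Fixpoint past_code n (w : Omega) : nat :=
  if n is m.+1 then choice.pickle (past_code m w, X n true w, X n false w) else 0%N.

Lemma past_codeP n w w' : past_code n w = past_code n w' <->
  (forall s c, (0 < s <= n)%N -> X s c w = X s c w').
Proof.
elim: n => [|n IH]; first by split=> // _ s c /andP[]; case: s.
split=> [/(pcan_inj choice.pickleK) [/IH h ht hf] s c|h].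
  move=> /andP[s0]; rewrite leq_eqVlt => /predU1P[->|sn]; first by case: c.
  by apply: h; rewrite s0.
rewrite /=; have -> : past_code n w = past_code n w'.
  by apply/IH => s c /andP[s0 sn]; apply: h; rewrite s0 ltnW.
by rewrite !h ?leqnn.
Qed.

(** The history up to time [n] contains the events that fix the values of the
    finitely many jumps up to [n], so the model gives the conditional law on each
    of them. *)
Lemma history_fiber n w0 : history X n (past_code n @^-1` [set past_code n w0]).
Proof.
rewrite /history; set G := [set A | _].
pose V := g_sigma_algebraType G.
have -> : past_code n @^-1` [set past_code n w0] =
    \bigcap_(s in [set s | (0 < s <= n)%N])
      (X s true @^-1` [set X s true w0] `&` X s false @^-1` [set X s false w0]).
  apply/seteqP; split => w /=.
    by move=> /past_codeP h s sn; split; apply: h.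
  by move=> h; apply/past_codeP => s c sn; have [] := h s sn; case: c.
suff : measurable (\bigcap_(s in [set s | (0 < s <= n)%N])
      (X s true @^-1` [set X s true w0] `&` X s false @^-1` [set X s false w0]) : set V) by [].
apply: bigcap_measurableType => s sn.
have gen c U : (measurable (X s c @^-1` U : set V)).
  by apply: sub_sigma_algebra; exists s, c, U.
exact: measurableI (gen _ _) (gen _ _).
Qed.

Lemma measurable_past_code n k : measurable (past_code n @^-1` [set k]).
Proof.
elim: n k => [|n IH] k.
  rewrite (_ : _ @^-1` _ = if k == 0%N then setT else set0); first by case: ifP.
  by case: eqP => [->|ne]; apply/seteqP; split => w //= h; case: ne.
case E : (choice.unpickle k : option (nat * nat * nat)) => [[[i a] b]|].
  have [->|ne] := eqVneq k (choice.pickle (i, a, b)).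
    rewrite (_ : _ @^-1` _ = past_code n @^-1` [set i] `&` (X n.+1 true @^-1` [set a] `&`
        X n.+1 false @^-1` [set b])).
      by apply: measurableI => //; apply: measurableI; exact: measurable_RV_fiber.
    apply/seteqP; split => w /=; first by move=> /(pcan_inj choice.pickleK)[-> -> ->].
    by move=> [-> [-> ->]].
  rewrite (_ : _ @^-1` _ = set0) //; apply/seteqP; split => // w /= h.
  by move: E; rewrite -h choice.pickleK => -[ei ea eb]; move: ne; rewrite -h ei ea eb eqxx.
rewrite (_ : _ @^-1` _ = set0) //; apply/seteqP; split => // w /= h.
by move: E; rewrite -h choice.pickleK.
Qed.

Lemma rate_jumps n w : (0 < n)%N -> 1 + beta p != 0 ->
  rate (q p tau) (muhat p tau) jumps n w = intensity p tau X n w.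
Proof.
move=> n0 b0; rewrite /rate /intensity; congr (_ + _).
rewrite big_ltn// big_bool /jumps /= !mulr0 !add0r mulr_sumr !big_nat.
apply: eq_bigr => -[//|s] _; rewrite big_bool /= /q; field.
exact: b0.
Qed.

(** On an event fixing the past, the intensity is a constant [l], and the model
    reads as the product formula of [poisson_family]. *)
Lemma jumps_law n w0 (v : bool -> R[i]) : 1 + beta p != 0 ->
  let A := fiber past_code n w0 in
  cint P A (fun w => cexp (\sum_c v c * (jumps n.+1 c w)%:R))
    ((fine (P A))%:C%C *
     cexp ((rate (q p tau) (muhat p tau) jumps n.+1 w0)%:C%C * \sum_c (cexp (v c) - 1))).
Proof.
move=> b0 A; have mA : measurable A by exact: measurable_past_code.
set l := rate _ _ _ _ _.
have fA : P A = (fine (P A))%:E by rewrite fineK//; exact: fin_num_measure.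
have lE w : A w -> intensity p tau X n.+1 w = l.
  move=> /past_codeP Aw; rewrite /l rate_jumps// /intensity; congr (_ + _ * _).
  rewrite !big_nat; apply: eq_bigr => s sn.
  by rewrite !Aw// -ltnS.
have law j k : P (A `&` (X n.+1 true @^-1` [set j] `&` X n.+1 false @^-1` [set k])) =
    (fine (P A) * (poisson_pmf l j * poisson_pmf l k))%:E.
  rewrite (hX (n := n.+1)) //=; last exact: history_fiber.
  rewrite (eq_integral (fun=> (poisson_pmf l j * poisson_pmf l k)%:E)).
    by rewrite integral_cst// [X in (_ * X)%E]fA -EFinM mulrC.
  by move=> w /[!inE] Aw; rewrite lE.
have [l0|l0] := ltP 0 l.
  have := @poisson_family R _ Omega P bool (X n.+1) (fun=> l) [:: true; false] _ _ _ A
     (fine (P A)) mA _ v.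
  rewrite -big_distrr /= !big_cons !big_nil addr0 big_bool.
  under eq_fun do rewrite !big_cons big_nil addr0.
  under [in X in _ -> X]eq_fun do rewrite big_bool.
  apply => //.
  - by move=> i k; exact: measurable_RV_fiber.
  - move=> k; rewrite !big_cons big_nil mulr1 -law; congr (P (_ `&` _)).
    apply/seteqP; split => w /=; first by move=> /and3P[/eqP ? /eqP ? _].
    by move=> [-> ->]; rewrite !eqxx.
(* [poisson_pmf] takes the value 1 everywhere at a nonpositive rate; the event
   [A] then meets two disjoint events in probability [P A] each, so it is null *)
have pmf1 k : poisson_pmf l k = 1 by rewrite /poisson_pmf ltNge l0.
have A0 : P A = 0.
  pose E k := A `&` (X n.+1 true @^-1` [set 0%N] `&` X n.+1 false @^-1` [set k]).
  have mE k : measurable (E k).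
    by apply: measurableI => //; apply: measurableI; exact: measurable_RV_fiber.
  have PE k : P (E k) = (fine (P A))%:E by rewrite law !pmf1 !mulr1.
  have : (P (E 0%N `|` E 1%N) <= P A)%E.
    by apply: le_measure; rewrite ?inE//; [exact: measurableU|move=> w [[]|[]]].
  rewrite measureU//; last first.
    by apply/seteqP; split => // w [[_ [_ h0]] [_ [_ h1]]]; move: h1; rewrite /= h0.
  rewrite [X in (X + _)%E]PE [X in (_ + X)%E]PE fA -EFinD lee_fin => h.
  have : 0 <= fine (P A) by exact: fine_ge0.
  by move=> h'; congr EFin; lra.
rewrite A0 /= mul0r; apply: cint_null => //.
  apply: (measurable_fun_determined mA (measurable_past_code n.+1)) => w w' /past_codeP h.
  by rewrite /=; congr (complex.Re (cexp _)); apply: eq_bigr => c _; rewrite /= h ?leqnn.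
apply: (measurable_fun_determined mA (measurable_past_code n.+1)) => w w' /past_codeP h.
by rewrite /=; congr (complex.Im (cexp _)); apply: eq_bigr => c _; rewrite /= h ?leqnn.
Qed.

Lemma price_transform (z : R[i]) (g : nat -> R[i]) : 1 + beta p != 0 ->
  (forall l, (l < N_ p tau)%N -> g l =
     \sum_c (cexp (Theta p tau c z + \sum_(1 <= k < l.+1) (q p tau c k)%:C%C * g (l - k)%N) - 1)) ->
  Phi p tau X z = cexp (\sum_(1 <= m < (N_ p tau).+1)
                (muhat p tau m)%:C%C * g (N_ p tau - m)%N).
Proof.
move=> b0 hg; apply: cint_cexpectation.
have := @branching_transform R _ Omega P (q p tau) (muhat p tau) jumps past_code (fun=> 0%N)
  measurable_past_code (fun _ _ => erefl) _ _ (fun c => Theta p tau c z) (N_ p tau) g hg.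
rewrite big1 ?add0r => [h|c _]; last by rewrite mulr0.
apply: eq_cint (h _ _) => //.
- move=> w _; congr cexp; rewrite big_bool /log_price /count_upto /Theta.
  rewrite !(big_ltn (ltn0Sn _)) /= !add0n.
  have E c : (\sum_(1 <= s < (N_ p tau).+1) jumps s c w = \sum_(1 <= s < (N_ p tau).+1) X s c w)%N.
    by rewrite !big_nat; apply: eq_bigr => -[].
  rewrite !E !natr_complex; move: (c_ p tau) (d_ p tau) => x y.
  by rewrite !(rmorphB, rmorphM); ring.
- by move=> n w w' /past_codeP hw [|s] c sn //=; exact: hw.
- by move=> n w0 v; exact: jumps_law.
Qed.

End PriceTransform.

(** * Growth of the cluster tree *)

Section ClusterGrowth.
Context (R : realType) d (Omega : measurableType d) (P : probability Omega R).
Variables (xi : label -> nat -> bool -> {RV P >-> nat}) (c0 : bool).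

(** The slot [(v, k, c)] stands for the type-[c] children that [v] has [k] steps
    after its birth. *)
Definition slot : Type := (label * nat * bool)%type.

Definition litter (i : slot) (w : Omega) : nat := xi i.1.1 i.1.2 i.2 w.

(** The slots that yield the individuals born at time [n + 1], when [s] lists the
    individuals born up to time [n]. *)
Definition slots n (s : seq label) : seq slot :=
  [seq (v, (n.+1 - birth_time v)%N, c) | v <- s, c <- [:: true; false]].

Definition brood (s : seq slot) w : seq label :=
  [seq (i.1.2, i.2, j) :: i.1.1 | i <- s, j <- iota 0 (litter i w)].

(** The individuals born up to time [n], listed in order of birth. Growing the tree
    by time steps rather than by generations makes time [n + 1] depend on the past
    only through [tree n] and through the slots falling at [n + 1], none of which
    has been used before. *)
Fixpoint tree n w : seq label :=
  if n is m.+1 then tree m w ++ brood (slots m (tree m w)) w else [:: [::]].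

Definition generation n w : seq label :=
  if n is m.+1 then brood (slots m (tree m w)) w else [:: [::]].

(** The slots whose litter sizes determine [tree n]. *)
Fixpoint revealed n w : seq slot :=
  if n is m.+1 then slots m (tree m w) ++ revealed m w else [::].

Fixpoint growth_code n w : nat :=
  if n is m.+1 then
    choice.pickle (growth_code m w, [seq litter i w | i <- slots m (tree m w)])
  else 0%N.

Definition newborns n c w : nat :=
  count (fun u => label_type c0 u == c) (generation n w).

Lemma birth_time_cons k c j u : birth_time ((k, c, j) :: u) = (k + birth_time u)%N.
Proof. by rewrite /birth_time big_cons. Qed.

Lemma mem_tree n w u : (u \in tree n w) = born xi w u && (birth_time u <= n)%N.
Proof.
elim: n u => [|n IH] u.
  rewrite inE; case: u => [|[[k c] j] u]; first by rewrite /birth_time big_nil.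
  rewrite birth_time_cons /=; case: k => [|k]; rewrite ?andbF//.
rewrite mem_cat IH; apply/idP/idP.
  move=> /orP[/andP[-> h]|]; first by rewrite (leq_trans h).
  move=> /allpairsPdep[_ [j [/allpairsP[[v c] /= [vt _ ->]]]]].
  rewrite mem_iota add0n /= => jl ->; rewrite birth_time_cons /=.
  move: vt; rewrite IH => /andP[-> vn]; rewrite jl subn_gt0 ltnS vn /= subnK//.
  exact: leqW.
case: u => [|[[k c] j] u]; first by rewrite /birth_time big_nil.
move=> /andP[bu]; rewrite leq_eqVlt => /orP[/eqP bn|]; last first.
  by rewrite ltnS bu => ->.
apply/orP; right; move: bu bn; rewrite birth_time_cons /= => /and3P[bu k0 jl] bn.
apply/allpairsPdep; exists (u, k, c), j; split => //; last by rewrite mem_iota.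
apply/allpairsP; exists (u, c) => /=; split => //.
- by rewrite IH bu /= -ltnS -bn -[X in (X < _)%N]add0n ltn_add2r.
- by case: c {jl}; rewrite !inE.
- by rewrite -bn addnK.
Qed.

Lemma slots_lag n w i : i \in slots n (tree n w) ->
  (0 < i.1.2)%N /\ (i.1.2 + birth_time i.1.1)%N = n.+1.
Proof.
move=> /allpairsP[[v c] /= [vt _ ->]] /=.
move: vt; rewrite mem_tree => /andP[_ vn]; rewrite subn_gt0 ltnS vn subnK//.
exact: leqW.
Qed.

Lemma slots_uniq n (s : seq label) : uniq s -> uniq (slots n s).
Proof. by move=> us; apply: allpairs_uniq => // -[v c] [v' c'] _ _ [-> _ ->]. Qed.

Lemma generation_birth_time n w u : u \in generation n w -> birth_time u = n.
Proof.
case: n => [|n]; first by rewrite inE => /eqP->; rewrite /birth_time big_nil.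
move=> /allpairsPdep[i [j [/slots_lag[_ h] _ ->]]].
by rewrite birth_time_cons.
Qed.

Lemma tree_uniq n w : uniq (tree n w).
Proof.
elim: n => [//|n IH] /=; rewrite cat_uniq IH /=; apply/andP; split.
  apply/hasPn => u /(@generation_birth_time n.+1) bu.
  by rewrite mem_tree bu ltnn andbF.
apply: allpairs_uniq_dep; first exact: slots_uniq.
  by move=> i _; exact: iota_uniq.
by move=> [[[v k] c] j] [[[v' k'] c'] j'] _ _ [-> -> -> ->].
Qed.

Lemma revealed_lag n w i : i \in revealed n w ->
  (0 < i.1.2)%N /\ (i.1.2 + birth_time i.1.1 <= n)%N.
Proof.
elim: n => [//|n IH] /=; rewrite mem_cat => /orP[/slots_lag[-> ->//]|/IH[-> h]].
by split=> //; exact: leqW.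
Qed.

(** Slots revealed at different times differ by their lag, as lag plus birth time
    is the time of revelation. Hence the new litters are independent of the past. *)
Lemma revealed_uniq n w : uniq (slots n (tree n w) ++ revealed n w).
Proof.
elim: n => [|n IH]; first by rewrite cats0 slots_uniq.
rewrite cat_uniq slots_uniq ?tree_uniq//= IH andbT.
apply/hasPn => i /(@revealed_lag n.+1) [_ h]; apply/negP => /slots_lag[_ h'].
by rewrite h' ltnn in h.
Qed.

Lemma growth_code_tree n w w' : growth_code n w = growth_code n w' ->
  tree n w = tree n w'.
Proof.
elim: n => [//|n IH] /= /(pcan_inj choice.pickleK)[/IH <- /eq_in_map h].
congr (_ ++ _); rewrite /brood; congr flatten; apply/eq_in_map => i /h.
by rewrite /litter => ->.
Qed.

(** The code at time [n] records the revealed litter sizes in order. The slots to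
    which they belong are themselves determined by the earlier sizes, so having
    a given code amounts to prescribing finitely many of the independent litters. *)
Lemma growth_codeP n w w' : growth_code n w = growth_code n w' <->
  (forall i, i \in revealed n w' -> litter i w = litter i w').
Proof.
elim: n => [//|n IH]; split=> /=.
  move=> /(pcan_inj choice.pickleK)[/[dup] /growth_code_tree <- /IH h /eq_in_map hs] i.
  by rewrite mem_cat => /orP[/hs|/h].
move=> h; have e : growth_code n w = growth_code n w'.
  by apply/IH => i hi; apply: h; rewrite mem_cat hi orbT.
rewrite (growth_code_tree e) e; congr (choice.pickle (_, _)); apply/eq_in_map => i hi.
by apply: h; rewrite mem_cat hi.
Qed.

Lemma growth_code_generation n w w' : growth_code n w = growth_code n w' ->
  forall s, (s <= n)%N -> generation s w = generation s w'.
Proof.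
move=> e s sn.
have {}e : growth_code s w = growth_code s w'.
  elim: n sn e => [|n IH]; first by rewrite leqn0 => /eqP->.
  rewrite leq_eqVlt => /predU1P[->//|sn] /= /(pcan_inj choice.pickleK)[e _].
  exact: IH.
case: s e {sn} => [//|s] /= /(pcan_inj choice.pickleK)[/growth_code_tree <- /eq_in_map h].
rewrite /brood; congr flatten; apply/eq_in_map => i /h.
by rewrite /litter => ->.
Qed.

Lemma measurable_litter i U : measurable (litter i @^-1` U).
Proof. exact: measurable_RV_fiber. Qed.

Lemma measurable_growth_code n k : measurable (growth_code n @^-1` [set k]).
Proof.
have [[w0 <-]|no] := pselect (exists w0, growth_code n w0 = k); last first.
  rewrite (_ : _ @^-1` _ = set0)//; apply/seteqP; split => // w wk.
  by case: no; exists w.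
rewrite (_ : _ @^-1` _ = \bigcap_(i in [set` revealed n w0]) (litter i @^-1` [set litter i w0])).
  apply: fin_bigcap_measurable => // i _; exact: measurable_litter.
apply/seteqP; split => w /=; first by move=> /growth_codeP h i; exact: h.
by move=> h; apply/growth_codeP => i hi; apply: h.
Qed.

Lemma sum_count (V : zmodType) (F : bool -> V) (s : seq label) :
  \sum_(u <- s) F (label_type c0 u) =
  \sum_c F c *+ count (fun u => label_type c0 u == c) s.
Proof.
elim: s => [|u s IH]; first by rewrite big_nil big1// => c _; rewrite mulr0n.
rewrite big_cons IH !big_bool /=.
by case: (label_type c0 u); rewrite !mulrnDr mulr1n mulr0n add0r; [rewrite addrA|rewrite addrCA].
Qed.

Lemma sum_tree (V : zmodType) (F : nat -> bool -> V) n w :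
  \sum_(u <- tree n w) F (birth_time u) (label_type c0 u) =
  \sum_(0 <= s < n.+1) \sum_c F s c *+ newborns s c w.
Proof.
have gen s : \sum_(u <- generation s w) F (birth_time u) (label_type c0 u) =
    \sum_c F s c *+ newborns s c w.
  rewrite -sum_count !big_seq; apply: eq_bigr => u /generation_birth_time.
  by move=> ->.
elim: n => [|n IH]; first by rewrite big_nat1 -gen.
by rewrite [RHS]big_nat_recr//= -IH -gen big_cat.
Qed.

Lemma newbornsS n c w :
  newborns n.+1 c w = (\sum_(i <- slots n (tree n w)) (i.2 == c) * litter i w)%N.
Proof.
rewrite /newborns /= /brood; elim: slots => [|i s IH]; first by rewrite big_nil.
rewrite big_cons -IH /= count_cat count_map; congr (_ + _)%N.
rewrite (@eq_count _ _ (fun=> i.2 == c)) //.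
case: (i.2 == c); last by rewrite mul0n (@eq_count _ _ pred0)// count_pred0.
by rewrite mul1n (@eq_count _ _ predT)// count_predT size_iota.
Qed.

Lemma K_newborns n c w :
  K_ xi c0 n c w = (\sum_(0 <= s < n.+1) newborns s c w)%N.
Proof.
have -> : (\sum_(0 <= s < n.+1) newborns s c w)%N =
    count (fun u => label_type c0 u == c) (tree n w).
  elim: n => [|n IH]; first by rewrite big_nat1.
  by rewrite big_nat_recr// IH /= count_cat.
rewrite /K_ -size_filter.
set s := [seq _ <- _ | _].
have us : uniq s by rewrite filter_uniq// tree_uniq.
rewrite -(undup_id us) -card_fseq; congr (#|` _|).
rewrite -[RHS]set_fsetK; congr fset_set; apply/seteqP; split => u /=.
  by move=> [bu uc un]; rewrite in_fset /= mem_filter uc eqxx mem_tree bu un.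
by rewrite in_fset /= mem_filter mem_tree => /and3P[/eqP -> -> ->].
Qed.

End ClusterGrowth.

(** * The cluster transform *)

Section ClusterTransform.
Context (R : realType) (p : params R) (tau : nat).
Context d (Omega : measurableType d) (P : probability Omega R).
Variables (xi : label -> nat -> bool -> {RV P >-> nat}) (c0 : bool).
Hypothesis hxi : branching p tau xi c0.

Definition litter_rate (i : slot) : R := q p tau (label_type c0 i.1.1) i.1.2.

(** [poisson_pmf] is not a mass function at a nonpositive rate: the events that a
    litter has 0 and 1 elements would both have probability 1. *)
Lemma litter_rate_gt0 (i : slot) : (0 < i.1.2)%N -> 0 < litter_rate i.
Proof.
move=> i0; rewrite ltNge; apply/negP => l0.
have P1 k : P (litter xi i @^-1` [set k]) = 1%E.
  by rewrite hxi.1// /poisson_pmf ltNge -/(litter_rate i) l0.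
have : (P (litter xi i @^-1` [set 0%N] `|` litter xi i @^-1` [set 1%N]) <= 1)%E.
  by apply: probability_le1; apply: measurableU; exact: measurable_litter.
rewrite measureU; [|exact: measurable_litter|exact: measurable_litter|]; last first.
  by apply/seteqP; split => // w [/= ->].
by rewrite [X in (X + _)%E]P1 [X in (_ + X)%E]P1 -EFinD lee_fin gerDl ler10.
Qed.

Lemma litters_law (s : seq slot) (k : slot -> nat) : uniq s ->
  (forall i, i \in s -> (0 < i.1.2)%N) ->
  P [set w | all (fun i => litter xi i w == k i) s] =
  (\prod_(i <- s) poisson_pmf (litter_rate i) (k i))%:E.
Proof.
move=> us s0.
have := hxi.2 [fset i in s]%fset (fun i => [set k i]) _.
rewrite (_ : \bigcap_(i in _) _ = [set w | all (fun i => litter xi i w == k i) s]).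
  move=> ->; last by move=> i /=; rewrite in_fset /= => /s0.
  rewrite -prodEFin; have ps : perm_eq [fset i in s]%fset s.
    by apply: uniq_perm => // i; rewrite in_fset.
  rewrite (perm_big _ ps) /= !big_seq; apply: eq_bigr => i si.
  by rewrite hxi.1// s0.
apply/seteqP; split => w /=.
  by move=> h; apply/allP => i si; apply/eqP; apply: h; rewrite /= in_fset.
by move=> /allP h i /=; rewrite in_fset /= => /h/eqP.
Qed.

(** Independence factors the probability of an event fixing both the past and the
    new litters; [poisson_family] then gives their joint transform, in which the
    rates of all the slots of one type add up to [rate]. *)
Lemma newborns_law n w0 (v : bool -> R[i]) :
  let A := fiber (growth_code xi) n w0 in
  cint P A (fun w => cexp (\sum_c v c * (newborns xi c0 n.+1 c w)%:R))
    ((fine (P A))%:C%C *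
     cexp ((rate (q p tau) (fun=> 0) (newborns xi c0) n.+1 w0)%:C%C * \sum_c (cexp (v c) - 1))).
Proof.
move=> A; have mA : measurable A by exact: measurable_growth_code.
set s := slots n (tree xi n w0); set r := revealed xi n w0.
have usr : uniq (s ++ r) by exact: revealed_uniq.
have sr0 i : i \in s ++ r -> (0 < i.1.2)%N.
  by rewrite mem_cat => /orP[/slots_lag[]|/revealed_lag[]].
have Ar : A = [set w | all (fun i => litter xi i w == litter xi i w0) r].
  apply/seteqP; split => w /=.
    by move=> /growth_codeP h; apply/allP => i /h ->.
  by move=> /allP h; apply/growth_codeP => i /h/eqP.
have us : uniq s by move: usr; rewrite cat_uniq => /and3P[].
have ur : uniq r by move: usr; rewrite cat_uniq => /and3P[].
have PA : fine (P A) = \prod_(i <- r) poisson_pmf (litter_rate i) (litter xi i w0).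
  by rewrite Ar litters_law// => i ir; apply: sr0; rewrite mem_cat ir orbT.
have law (k : slot -> nat) : P (A `&` [set w | all (fun i => litter xi i w == k i) s]) =
    (fine (P A) * \prod_(i <- s) poisson_pmf (litter_rate i) (k i))%:E.
  (* prescribe the new litters by [k] and the revealed ones by the sample [w0] *)
  pose k' i := if i \in s then k i else litter xi i w0.
  have ks : {in s, k =1 k'} by move=> i si; rewrite /k' si.
  have kr : {in r, litter xi ^~ w0 =1 k'}.
    move=> i ir; rewrite /k' ifN//; apply/negP => si.
    by move: usr; rewrite cat_uniq => /and3P[_ /hasPn/(_ i ir)/negP].
  rewrite PA mulrC !big_seq (eq_bigr _ (fun i si => congr1 _ (ks i si))) -!big_seq.
  rewrite [X in _ * X]big_seq (eq_bigr _ (fun i si => congr1 _ (kr i si))) -big_seq.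
  rewrite -big_cat /= -litters_law//; congr (P _).
  rewrite Ar; apply/seteqP; split => w /=; rewrite all_cat.
    move=> [hr hs]; apply/andP; split.
      by apply/allP => i si; rewrite -ks// (allP hs).
    by apply/allP => i si; rewrite -kr// (allP hr).
  move=> /andP[hs hr]; split.
    by apply/allP => i si; rewrite kr// (allP hr).
  by apply/allP => i si; rewrite ks// (allP hs).
have sl0 i : i \in s -> 0 < litter_rate i.
  by move=> si; apply: litter_rate_gt0; apply: sr0; rewrite mem_cat si.
have := poisson_family (fun i k => measurable_litter xi i [set k]) us sl0 mA law (fun i => v i.2).
have -> : \sum_(i <- s) (litter_rate i)%:C%C * (cexp (v i.2) - 1) =
    (rate (q p tau) (fun=> 0) (newborns xi c0) n.+1 w0)%:C%C * \sum_c (cexp (v c) - 1).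
  rewrite /s /slots big_allpairs_dep /= /rate add0r.
  have -> : \sum_(0 <= t < n.+1) \sum_c q p tau c (n.+1 - t) * (newborns xi c0 t c w0)%:R =
     \sum_(u <- tree xi n w0) q p tau (label_type c0 u) (n.+1 - birth_time u).
    rewrite (sum_tree xi c0 (fun b c => q p tau c (n.+1 - b))); apply: eq_bigr => t _.
    by apply: eq_bigr => c _; rewrite mulr_natr.
  rewrite rmorph_sum mulr_suml; apply: eq_bigr => u _.
  by rewrite !big_cons big_nil addr0 big_bool /litter_rate -mulrDr.
apply: eq_cint => // w Aw; congr cexp.
have e : tree xi n w = tree xi n w0 by apply: growth_code_tree.
under [RHS]eq_bigr do rewrite newbornsS e natr_sum mulr_sumr.
rewrite exchange_big; apply: eq_bigr => i _; rewrite big_bool /=.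
by case: i.2; rewrite ?mul1n ?mul0n ?mulr0 ?addr0 ?add0r.
Qed.

(** No immigration, and one initial individual of type [c0]: [branching_transform]
    leaves the weight of the root. *)
Lemma cluster_transform (z : R[i]) n (g : nat -> R[i]) :
  (forall l, (l < n)%N -> g l =
     \sum_c (cexp (Theta p tau c z + \sum_(1 <= k < l.+1) (q p tau c k)%:C%C * g (l - k)%N) - 1)) ->
  M_ p tau xi c0 n z =
  cexp (Theta p tau c0 z + \sum_(1 <= k < n.+1) (q p tau c0 k)%:C%C * g (n - k)%N).
Proof.
move=> hg; apply: cint_cexpectation.
have h := @branching_transform R _ Omega P (q p tau) (fun=> 0) (newborns xi c0)
  (growth_code xi) (fun c => (c0 == c) : nat) (measurable_growth_code xi)
  _ _ newborns_law (fun c => Theta p tau c z) n g hg.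
rewrite [X in cexp X](_ : _ =
    \sum_c (Theta p tau c z +
             \sum_(1 <= k < n.+1) (q p tau c k)%:C%C * g (n - k)%N) * (c0 == c)%:R +
    \sum_(1 <= m < n.+1) (0 : R)%:C%C * g (n - m)%N).
  apply: eq_cint (h _ _) => //.
  - by move=> w _; congr cexp; rewrite big_bool !K_newborns.
  - by move=> c w; rewrite /newborns /= addn0.
  - by move=> t w w' e s c st; rewrite /newborns (growth_code_generation e).
rewrite [X in _ = _ + X]big1 => [|k _]; last by rewrite mul0r.
rewrite addr0 big_bool.
by case: c0; rewrite /= ?mulr1 ?mulr0 ?addr0 ?add0r.
Qed.

End ClusterTransform.

(** * The recursions and the price transform *)

Theorem proposition3p7 (R : realType) (p : params R)
  (halpha : 1 / 2 < alpha p < 1) (hbeta : 1 < beta p) (hgamma : 0 < gamma p)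
  (hmu : 0 < mu p) (hxi0 : 0 < xi0 p) (htheta : 0 < theta p)
  (hT : 0 < horizon p)
  (tau : nat) (htau : (1 <= tau)%N) (ha : 0 < a_ p tau < 1)
  (dX : measure_display) (OmegaX : measurableType dX)
  (PX : probability OmegaX R) (X : nat -> bool -> {RV PX >-> nat})
  (hX : price_model p tau X)
  (dC : measure_display) (OmegaC : measurableType dC)
  (PC : probability OmegaC R)
  (xi : bool -> label -> nat -> bool -> {RV PC >-> nat})
  (hxi : forall c0 : bool, branching p tau (xi c0) c0)
  (z : R[i]) (hz : moment_domain p tau X z) :
  let Mp := fun n => M_ p tau (xi true) true n z in
  let Mm := fun n => M_ p tau (xi false) false n z in
  let G := fun n => Mp n + Mm n - 2 in
  let Tp := Theta p tau true z in
  let Tm := Theta p tau false z in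
  [/\ forall n, (1 <= n)%N ->
        Mp n = cexp (Tp + \sum_(1 <= k < n.+1)
                      (q p tau true k)%:C%C * (Mp (n - k)%N + Mm (n - k)%N - 2))
        /\
        Mm n = cexp (Tm + \sum_(1 <= k < n.+1)
                      (q p tau false k)%:C%C * (Mp (n - k)%N + Mm (n - k)%N - 2)),
      forall n, (1 <= n)%N ->
        G n = cexp (Tp + \sum_(1 <= k < n.+1)
                      (q p tau true k)%:C%C * G (n - k)%N)
              + cexp (Tm + \sum_(1 <= k < n.+1)
                      (q p tau false k)%:C%C * G (n - k)%N)
              - 2
    & Phi p tau X z =
        cexp (\sum_(1 <= m < (N_ p tau).+1)
                (muhat p tau m)%:C%C * G (N_ p tau - m)%N)].
Proof.
move=> Mp Mm G Tp Tm.
have GE l : G l = \sum_c (M_ p tau (xi c) c l z - 1).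
  by rewrite big_bool /= addrACA -opprD.
have M_rec n c : M_ p tau (xi c) c n z =
    cexp (Theta p tau c z + \sum_(1 <= k < n.+1) (q p tau c k)%:C%C * G (n - k)%N).
  elim/ltn_ind: n c => n IH c; apply: cluster_transform; first exact: hxi.
  by move=> l ln; rewrite GE; apply: eq_bigr => c' _; rewrite IH.
have G_rec l : G l = \sum_c (cexp (Theta p tau c z +
    \sum_(1 <= k < l.+1) (q p tau c k)%:C%C * G (l - k)%N) - 1).
  by rewrite GE; apply: eq_bigr => c _; rewrite M_rec.
split.
- by move=> n _; split; exact: M_rec.
- by move=> n _; rewrite {1}G_rec big_bool /= addrACA -opprD.
- by apply: price_transform => //; rewrite gt_eqF//; lra.
Qed.
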